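(* Let $d\geq 2$, let $\Delta_d$ be a $d$-simplex, and let $G$ be its automorphism group. Let $\Bbbk$ be a field of characteristic $2$. Then there is no $G$-equivariant $\Bbbk[\Theta]$-module isomorphism $\Bbbk[\operatorname{Sd}\Delta_d]\rightarrow\Bbbk[\Delta_d]$.
   Context: Let $n=d+1$ and let $V=\{0,\dots,d\}$ be the vertex set of the $d$-simplex $\Delta_d$, viewed as the simplicial complex whose faces are all subsets of $V$. Its automorphism group is $G=\mathfrak{S}_n$, all permutations of $V$. The Stanley--Reisner ring of $\Delta_d$ is the polynomial ring $\Bbbk[\Delta_d]=\Bbbk[x_0,\dots,x_d]$. For $j=1,\dots,n$ let $\theta_j=\sum_{\alpha\subseteq V,\,|\alpha|=j}\prod_{v\in\alpha}x_v$, the $j$-th elementary symmetric polynomial, and let $\Bbbk[\Theta]=\Bbbk[\theta_1,\dots,\theta_n]\subset\Bbbk[\Delta_d]$. The barycentric subdivision $\operatorname{Sd}\Delta_d$ is the order complex of the poset of nonempty subsets of $V$ ordered by inclusion. Its Stanley--Reisner ring is $$\Bbbk[\operatorname{Sd}\Delta_d]=\Bbbk[y_\alpha : \varnothing\neq\alpha\subseteq V]/(y_\alpha y_\beta : \alpha\not\subseteq\beta\text{ and }\beta\not\subseteq\alpha).$$ For $j=1,\dots,n$ let $\gamma_j=\sum_{|\alpha|=j}y_\alpha$. Both $\theta_1,\dots,\theta_n$ and $\gamma_1,\dots,\gamma_n$ are algebraically independent over $\Bbbk$. $\Bbbk[\Theta]$-module structures: $\Bbbk[\Delta_d]$ is a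 $\Bbbk[\Theta]$-module via the inclusion $\Bbbk[\Theta]\subset\Bbbk[\Delta_d]$; $\Bbbk[\operatorname{Sd}\Delta_d]$ is a $\Bbbk[\Theta]$-module via the $\Bbbk$-algebra homomorphism $\Bbbk[\Theta]\to\Bbbk[\operatorname{Sd}\Delta_d]$, $\theta_j\mapsto\gamma_j$. $G$ acts by $\Bbbk$-algebra automorphisms via $\sigma\cdot x_v=x_{\sigma(v)}$ and $\sigma\cdot y_\alpha=y_{\sigma(\alpha)}$. *)

(* Defs.v *)
From HB Require Import structures.
From mathcomp Require Import all_boot all_order all_algebra all_fingroup.
From mathcomp Require Import generic_quotient ring_quotient.
From mathcomp Require Import mpoly boolp.

Set Implicit Arguments.
Unset Strict Implicit.
Unset Printing Implicit Defensive.

Import GRing.Theory.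

Local Open Scope ring_scope.
Local Open Scope quotient_scope.

Section Simplex.
Variables (d : nat) (k : fieldType).

(* A plain copy of the polynomial ring: its only module structure, declared   *)
(* below, is the one over [kTheta], not the one over [k].                     *)
Definition kDelta : Type := {mpoly k[d.+1]}.
HB.instance Definition _ := GRing.ComNzRing.on kDelta.

Definition actDelta (s : 'S_d.+1) (p : kDelta) : kDelta := msym s p.

Lemma actDeltaX s v : actDelta s 'X_v = 'X_(s v).
Proof. by rewrite /actDelta /msym mmapX mmap1U. Qed.

(* The tuple index i stands for j = i + 1.                                    *)
Definition thetas : d.+1.-tuple {mpoly k[d.+1]} :=
  [tuple mesym d.+1 k i.+1 | i < d.+1].

Lemma thetasE (i : 'I_d.+1) : tnth thetas i =
  \sum_(alpha : {set 'I_d.+1} | #|alpha| == i.+1) \prod_(v in alpha) 'X_v.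
Proof. by rewrite tnth_mktuple. Qed.

Definition in_kTheta : {pred {mpoly k[d.+1]}} :=
  fun p => `[< exists q : {mpoly k[d.+1]}, p = q \mPo thetas >].

Lemma in_kTheta_subring_closed : subring_closed in_kTheta.
Proof.
split=> [|p q|p q].
- by apply/asboolP; exists 1; rewrite rmorph1.
- move=> /asboolP[p' ->] /asboolP[q' ->].
  by apply/asboolP; exists (p' - q'); rewrite rmorphB.
- move=> /asboolP[p' ->] /asboolP[q' ->].
  by apply/asboolP; exists (p' * q'); rewrite rmorphM.
Qed.

HB.instance Definition _ :=
  GRing.isSubringClosed.Build {mpoly k[d.+1]} in_kTheta in_kTheta_subring_closed.

Record kTheta : Type :=
  KTheta { theta_val : {mpoly k[d.+1]}; theta_valP : theta_val \in in_kTheta }.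

HB.instance Definition _ := [isSub for theta_val].
HB.instance Definition _ := [Choice of kTheta by <:].
HB.instance Definition _ := [SubChoice_isSubComNzRing of kTheta by <:].

Definition scaleDelta (a : kTheta) (u : kDelta) : kDelta := theta_val a * u.

Fact scaleDeltaA a b u :
  scaleDelta a (scaleDelta b u) = scaleDelta (a * b) u.
Proof. exact: mulrA. Qed.

Fact scaleDelta1 : left_id 1 scaleDelta.
Proof. exact: mul1r. Qed.

Fact scaleDeltaDr : right_distributive scaleDelta +%R.
Proof. by move=> a u v; apply: mulrDr. Qed.

Fact scaleDeltaDl u : {morph scaleDelta^~ u : a b / a + b}.
Proof. by move=> a b; apply: mulrDl. Qed.

HB.instance Definition _ := GRing.Zmodule_isLmodule.Build kTheta kDelta
  scaleDeltaA scaleDelta1 scaleDeltaDr scaleDeltaDl.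

End Simplex.

Section Subdivision.
Variables (d : nat) (k : fieldType).

Definition face : Type := {alpha : {set 'I_d.+1} | alpha != set0}.
HB.instance Definition _ := Finite.on face.
HB.instance Definition _ := SubType.on face.

(* k[y_alpha : alpha nonempty]: the variables are numbered by [enum_rank].    *)
Local Notation polySd := {mpoly k[#|{: face}|]}.

Definition Y (a : face) : polySd := 'X_(enum_rank a).

Definition incomparable (a b : face) : bool :=
  ~~ (val a \subset val b) && ~~ (val b \subset val a).

Definition in_idealSd : {pred polySd} :=
  fun p => `[< exists c : face -> face -> polySd,
    p = \sum_a \sum_(b | incomparable a b) c a b * (Y a * Y b) >].

Lemma in_idealSd_closed : idealr_closed in_idealSd.
Proof.
split=> [||r p q].
- apply/asboolP; exists (fun _ _ => 0).
  by rewrite big1 // => a _; rewrite big1 // => b _; rewrite mul0r.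
- apply/negP => /asboolP[c /(congr1 (meval (fun _ => 0)))].
  rewrite rmorph1 raddf_sum big1 => [/eqP|a _]; first by rewrite oner_eq0.
  rewrite raddf_sum big1 // => b _.
  by rewrite /= !rmorphM /= /Y mevalXU mul0r mulr0.
- move=> /asboolP[c ->] /asboolP[c' ->]; apply/asboolP.
  exists (fun a b => r * c a b + c' a b).
  rewrite mulr_sumr -big_split; apply: eq_bigr => a _ /=.
  rewrite mulr_sumr -big_split; apply: eq_bigr => b _ /=.
  by rewrite mulrDl -!mulrA.
Qed.

HB.instance Definition _ :=
  isIdealr.Build polySd in_idealSd in_idealSd_closed.

Definition kSd : Type := {ideal_quot in_idealSd}.
HB.instance Definition _ := GRing.ComNzRing.on kSd.
HB.instance Definition _ : EqQuotient polySd (Quotient.equiv in_idealSd) kSd :=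
  EqQuotient.on kSd.

Definition piSd (p : polySd) : kSd := \pi_kSd p.

Lemma piSd_zmod_morphism : zmod_morphism piSd.
Proof. exact: (rmorphB \pi_{ideal_quot in_idealSd}). Qed.

Lemma piSd_monoid_morphism : monoid_morphism piSd.
Proof.
split; first exact: (rmorph1 \pi_{ideal_quot in_idealSd}).
exact: (rmorphM \pi_{ideal_quot in_idealSd}).
Qed.

HB.instance Definition _ :=
  GRing.isZmodMorphism.Build polySd kSd piSd piSd_zmod_morphism.
HB.instance Definition _ :=
  GRing.isMonoidMorphism.Build polySd kSd piSd piSd_monoid_morphism.

Lemma piSd_repr (u : kSd) : piSd (repr u) = u.
Proof. exact: reprK. Qed.

Lemma eq_piSd (p q : polySd) : (piSd p = piSd q) <-> (p - q \in in_idealSd).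
Proof.
rewrite (Quotient.idealrBE in_idealSd); exact: (rwP eqP).
Qed.

Lemma piSd_incomparable (a b : face) :
  ~~ (val a \subset val b) -> ~~ (val b \subset val a) ->
  piSd (Y a) * piSd (Y b) = 0.
Proof.
move=> ab ba; rewrite -rmorphM -[RHS](rmorph0 piSd); apply/eq_piSd.
rewrite subr0; apply/asboolP; exists (fun a' b' => ((a' == a) && (b' == b))%:R).
rewrite (bigD1 a) //= [X in _ + X]big1 ?addr0; last first.
  by move=> a' /negPf na; rewrite big1 // => b' _; rewrite na mul0r.
rewrite (bigD1 b) /=; last by rewrite /incomparable ab ba.
rewrite !eqxx mul1r big1 ?addr0 // => b' /andP[_ /negPf nb].
by rewrite nb andbF mul0r.
Qed.

Fact face_perm_subproof (s : 'S_d.+1) (a : face) : s @: val a != set0.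
Proof. by rewrite imset_eq0 (valP a). Qed.

Definition face_perm (s : 'S_d.+1) (a : face) : face :=
  exist _ (s @: val a) (face_perm_subproof s a).

Definition actPolySd (s : 'S_d.+1) (p : polySd) : polySd :=
  p \mPo [tuple Y (face_perm s (enum_val i)) | i < #|{: face}|].

HB.instance Definition _ s := GRing.RMorphism.copy (actPolySd s)
  (comp_mpoly [tuple Y (face_perm s (enum_val i)) | i < #|{: face}|]).

Lemma actPolySdY s a : actPolySd s (Y a) = Y (face_perm s a).
Proof. by rewrite /actPolySd /Y comp_mpolyXU -tnth_nth tnth_mktuple enum_rankK. Qed.

Lemma face_permK s : cancel (face_perm s) (face_perm s^-1).
Proof.
move=> a; apply/val_inj; rewrite /= -imset_comp -[RHS]imset_id.
by apply: eq_imset => v /=; rewrite permK.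
Qed.

Lemma incomparable_perm s a b :
  incomparable (face_perm s a) (face_perm s b) = incomparable a b.
Proof.
have sub (A B : {set 'I_d.+1}) : (s @: A \subset s @: B) = (A \subset B).
  apply/idP/idP => [/subsetP sAB|]; last exact: imsetS.
  apply/subsetP => v vA; have := sAB (s v) (imset_f s vA).
  by rewrite mem_imset //; apply: perm_inj.
by rewrite /incomparable /= !sub.
Qed.

Lemma actPolySd_ideal s p : p \in in_idealSd -> actPolySd s p \in in_idealSd.
Proof.
move=> /asboolP[c ->]; apply/asboolP.
pose t := face_perm s^-1.
have tK : cancel t (face_perm s) by move=> a; rewrite -{1}(invgK s) face_permK.
exists (fun a b => actPolySd s (c (t a) (t b))).
have bij : bijective (face_perm s) by exists t => //; apply: face_permK.
rewrite [RHS](reindex (face_perm s)); last exact: onW_bij.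
rewrite rmorph_sum; apply: eq_bigr => a _ /=.
rewrite [RHS](reindex (face_perm s)); last exact: onW_bij.
rewrite rmorph_sum; apply: eq_big => [b|b _] /=; first by rewrite incomparable_perm.
by rewrite !rmorphM /= !actPolySdY /t !face_permK.
Qed.

(* Defined on representatives; [actSd_pi] is the independence of the choice.  *)
Definition actSd (s : 'S_d.+1) (u : kSd) : kSd := piSd (actPolySd s (repr u)).

Lemma actSd_pi s p : actSd s (piSd p) = piSd (actPolySd s p).
Proof.
apply/eq_piSd; rewrite -rmorphB; apply: actPolySd_ideal; apply/eq_piSd.
exact: piSd_repr.
Qed.

Lemma actSdY s a : actSd s (piSd (Y a)) = piSd (Y (face_perm s a)).
Proof. by rewrite actSd_pi actPolySdY. Qed.

Definition gammas : d.+1.-tuple polySd :=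
  [tuple \sum_(a : face | #|val a| == i.+1) Y a | i < d.+1].

Fact kTheta_exists (a : kTheta d k) :
  exists q : {mpoly k[d.+1]}, theta_val a == q \mPo thetas d k.
Proof. by case: a => p /= /asboolP[q ->]; exists q. Qed.

Definition kTheta_poly (a : kTheta d k) : {mpoly k[d.+1]} :=
  xchoose (kTheta_exists a).

Lemma kTheta_polyP a : kTheta_poly a \mPo thetas d k = theta_val a.
Proof. exact/esym/eqP/(xchooseP (kTheta_exists a)). Qed.

(* Algebraic independence of the thetas.                                      *)
Lemma thetas_inj : injective (fun q : {mpoly k[d.+1]} => q \mPo thetas d k).
Proof. by move=> q q' /msym_fundamental_un. Qed.

Lemma kTheta_poly_unique a q :
  theta_val a = q \mPo thetas d k -> kTheta_poly a = q.
Proof. by move=> e; apply: thetas_inj; rewrite /= kTheta_polyP. Qed.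

(* The structure morphism k[Theta] -> k[Sd Delta_d], theta_j |-> gamma_j.     *)
Definition thetaToSd (a : kTheta d k) : kSd := piSd (kTheta_poly a \mPo gammas).

Lemma thetaToSdE a q : theta_val a = q \mPo thetas d k ->
  thetaToSd a = piSd (q \mPo gammas).
Proof. by move=> /kTheta_poly_unique; rewrite /thetaToSd => ->. Qed.

Lemma thetaToSd_const (a : kTheta d k) (c : k) :
  theta_val a = c%:MP -> thetaToSd a = piSd c%:MP.
Proof.
move=> ac; rewrite (@thetaToSdE _ c%:MP) ?comp_mpolyC //.
Qed.

Lemma thetaToSd_theta (a : kTheta d k) (i : 'I_d.+1) :
  theta_val a = tnth (thetas d k) i -> thetaToSd a = piSd (tnth gammas i).
Proof.
by move=> ai; rewrite (@thetaToSdE _ 'X_i) ?comp_mpolyXU -?tnth_nth.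
Qed.

Lemma thetaToSd_zmod_morphism : zmod_morphism thetaToSd.
Proof.
move=> a b; rewrite (@thetaToSdE _ (kTheta_poly a - kTheta_poly b)).
  by rewrite !rmorphB.
by rewrite rmorphB /= !kTheta_polyP.
Qed.

Lemma thetaToSd_monoid_morphism : monoid_morphism thetaToSd.
Proof.
split=> [|a b]; first by rewrite (@thetaToSdE _ 1) !rmorph1.
rewrite (@thetaToSdE _ (kTheta_poly a * kTheta_poly b)) ?rmorphM //=.
by rewrite !kTheta_polyP.
Qed.

HB.instance Definition _ := GRing.isZmodMorphism.Build (kTheta d k) kSd
  thetaToSd thetaToSd_zmod_morphism.
HB.instance Definition _ := GRing.isMonoidMorphism.Build (kTheta d k) kSd
  thetaToSd thetaToSd_monoid_morphism.

Definition scaleSd (a : kTheta d k) (u : kSd) : kSd := thetaToSd a * u.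

Fact scaleSdA a b u : scaleSd a (scaleSd b u) = scaleSd (a * b) u.
Proof. by rewrite /scaleSd rmorphM mulrA. Qed.

Fact scaleSd1 : left_id 1 scaleSd.
Proof. by move=> u; rewrite /scaleSd rmorph1 mul1r. Qed.

Fact scaleSdDr : right_distributive scaleSd +%R.
Proof. by move=> a u v; apply: mulrDr. Qed.

Fact scaleSdDl u : {morph scaleSd^~ u : a b / a + b}.
Proof. by move=> a b; rewrite /scaleSd rmorphD mulrDl. Qed.

HB.instance Definition _ := GRing.Zmodule_isLmodule.Build (kTheta d k) kSd
  scaleSdA scaleSd1 scaleSdDr scaleSdDl.

End Subdivision.

(* Main.v *)
Require Import Defs.
From HB Require Import structures.
From mathcomp Require Import all_boot all_order all_algebra all_fingroup.
From mathcomp Require Import mpoly boolp.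

Set Implicit Arguments.
Unset Strict Implicit.
Unset Printing Implicit Defensive.

Import GRing.Theory.

Local Open Scope ring_scope.

(** Traces obstruct the isomorphism.  Let tau = (v w) be a transposition of
vertices.  In k[Delta_d] an element p + tau p dies when x_v and x_w are
identified, because the characteristic is 2.  In k[Sd Delta_d] the product
gamma_1 ... gamma_d is of the form w + tau w ([prod_rank_sum_trace]): it is the
sum over the complete flags of faces of sizes 1, ..., d, and tau fixes none of
them, as some face of such a flag contains exactly one of v and w.

Let f be an equivariant isomorphism.  Applying it to gamma_1 ... gamma_d shows
that theta_1 ... theta_d * f 1 dies under the identification x_v = x_w.  None of
its factors does.  For theta_j, with j <= d and d >= 2, there is a j-element set
A of vertices containing both or neither of v and w; the monomial of A survives,
as evaluation at the indicator of A detects ([identify_mesym]).  As for f 1, it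
is invariant under G, hence equal to q(theta) for some q, and surjectivity of f
gives an inverse of q(gamma) in k[Sd Delta_d].  Projecting k[Sd Delta_d] to the
Stanley-Reisner ring of one complete flag, a polynomial ring in which gamma_j
becomes the j-th variable ([flag_proj_gammas]), shows that q itself is
invertible ([theta_unit_of_iso]), so that f 1 is a unit. *)

Lemma card_initial n j :
  (j <= n)%N -> #|[set v : 'I_n | (v < j)%N]| = j.
Proof.
move=> le_jn; rewrite cardsE -sum1_card.
rewrite (big_ord_narrow_cond (P := predT) le_jn) /=.
by rewrite sum1_card card_ord.
Qed.

(** * The product of the rank sums is a trace *)

Section InvariantProduct.
Variables (d : nat) (k : fieldType).

Definition rank_sum (j : nat) : {mpoly k[#|{: face d}|]} :=
  \sum_(a : face d | #|val a| == j.+1) Y k a.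

Lemma mem_face_perm (s : 'S_d.+1) (a : face d) (v : 'I_d.+1) :
  (v \in val (face_perm s a)) = ((s^-1)%g v \in val a).
Proof. by rewrite /= -{1}(permKV s v) mem_imset //; apply: perm_inj. Qed.

Lemma card_face_perm (s : 'S_d.+1) (a : face d) :
  #|val (face_perm s a)| = #|val a|.
Proof. by rewrite /= card_imset //; apply: perm_inj. Qed.

(** Sums of face variables are permuted by relabelling the faces; this yields
the action on all the partial rank sums below. *)
Lemma actPolySd_sum (s : 'S_d.+1) (P : pred (face d)) :
  actPolySd s (\sum_(a | P a) Y k a) =
  \sum_(a | P (face_perm (s^-1)%g a)) Y k a.
Proof.
rewrite rmorph_sum [RHS](reindex (face_perm s)) /=; last first.
  exists (face_perm (s^-1)%g) => a _; first exact: face_permK.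
  by rewrite -{1}(invgK s) face_permK.
apply: eq_big => [a|a _]; last exact: actPolySdY.
by rewrite face_permK.
Qed.

Lemma actPolySd_rank_sum s j : actPolySd s (rank_sum j) = rank_sum j.
Proof.
by rewrite actPolySd_sum; apply: eq_bigl => a; rewrite card_face_perm.
Qed.

Variables i0 i1 : 'I_d.+1.
Hypothesis neq_i : i0 != i1.

Let tau : 'S_d.+1 := tperm i0 i1.

Definition avoid_sum (j : nat) : {mpoly k[#|{: face d}|]} :=
  \sum_(a : face d | [&& #|val a| == j.+1, i0 \notin val a & i1 \notin val a])
     Y k a.

Definition contain_sum (j : nat) : {mpoly k[#|{: face d}|]} :=
  \sum_(a : face d | [&& #|val a| == j.+1, i0 \in val a & i1 \in val a])
     Y k a.

Definition split_sum (j : nat) : {mpoly k[#|{: face d}|]} :=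
  \sum_(a : face d | [&& #|val a| == j.+1, i0 \in val a & i1 \notin val a])
     Y k a.

Lemma actPolySd_avoid_sum j : actPolySd tau (avoid_sum j) = avoid_sum j.
Proof.
rewrite actPolySd_sum; apply: eq_bigl => a.
rewrite card_face_perm !mem_face_perm invgK tpermL tpermR.
by rewrite [(i1 \notin _) && _]andbC.
Qed.

(** The faces that contain i1 but not i0 are the images under tau of those that
contain i0 but not i1. *)
Lemma rank_sum_split j :
  rank_sum j = avoid_sum j + contain_sum j
               + (split_sum j + actPolySd tau (split_sum j)).
Proof.
rewrite actPolySd_sum /rank_sum (bigID (fun a : face d => i0 \in val a)) /=.
rewrite (bigID (fun a : face d => i1 \in val a)) /=.
rewrite [X in _ + X](bigID (fun a : face d => i1 \in val a)) /=.
rewrite [X in _ + X]addrC addrACA.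
rewrite [avoid_sum j + _]addrC.
congr (_ + _ + (_ + _)); apply: eq_bigl => a; rewrite -?andbA //.
rewrite card_face_perm !mem_face_perm invgK tpermL tpermR.
by rewrite [(i1 \in _) && _]andbC.
Qed.

(** A face cannot gain both i0 and i1 when its size grows by one only. *)
Lemma avoid_contain j : piSd (avoid_sum j) * piSd (contain_sum j.+1) = 0.
Proof.
rewrite !rmorph_sum mulr_suml big1 // => a /and3P[/eqP ca a0 a1].
rewrite mulr_sumr big1 // => b /and3P[/eqP cb b0 b1].
apply: piSd_incomparable; last first.
  by apply: contra a0 => /subsetP; apply.
apply/negP => ab.
have : i0 |: (i1 |: val a) \subset val b by rewrite !subUset !sub1set b0 b1.
by move=> /subset_leq_card; rewrite !cardsU1 !inE negb_or neq_i a0 a1 ca cb ltnn.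
Qed.

Lemma contain_sum0 : contain_sum 0 = 0.
Proof.
rewrite /contain_sum big1 // => a /and3P[/eqP ca a0 a1].
have : [set i0; i1] \subset val a by rewrite subUset !sub1set a0 a1.
by move=> /subset_leq_card; rewrite cards2 neq_i ca.
Qed.

Lemma avoid_sum_max : (0 < d)%N -> avoid_sum d.-1 = 0.
Proof.
move=> d_gt0; rewrite /avoid_sum big1 // => a /and3P[/eqP ca a0 a1].
have := max_card (mem (i0 |: (i1 |: val a))).
by rewrite !cardsU1 !inE negb_or neq_i a0 a1 ca card_ord prednK // ltnn.
Qed.

(** Modulo the elements w + tau w, which are stable under multiplication by
invariants, each rank sum is [avoid_sum + contain_sum].  A flag without face
separating i0 from i1 starts in the first summand, since a one-element face
cannot contain both, and can never move to the second one. *)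
Lemma prod_rank_sum m :
  exists W, piSd (\prod_(j < m) rank_sum j) =
    piSd (\prod_(j < m) avoid_sum j) + piSd (W + actPolySd tau W).
Proof.
elim: m => [|m [W IH]].
  by exists 0; rewrite !big_ord0 rmorph0 addr0 [piSd 0]rmorph0 addr0.
set Q := \prod_(j < m) avoid_sum j in IH *.
have QtQ : actPolySd tau Q = Q.
  by rewrite rmorph_prod; apply: eq_bigr => j _; apply: actPolySd_avoid_sum.
have Q0 : piSd (Q * contain_sum m) = 0.
  rewrite /Q; case: m {W IH Q QtQ} => [|m].
    by rewrite contain_sum0 mulr0 rmorph0.
  by rewrite big_ord_recr /= -mulrA !rmorphM avoid_contain mulr0.
exists (Q * split_sum m + W * rank_sum m).
rewrite !big_ord_recr /= -/Q rmorphM /= IH mulrDl -!rmorphM /=.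
rewrite {1}rank_sum_split !mulrDr rmorphD rmorphD /= Q0 addr0 -addrA.
congr (_ + _); rewrite -rmorphD; congr piSd.
rewrite rmorphD !rmorphM /= actPolySd_rank_sum QtQ mulrDl.
by rewrite addrACA.
Qed.

(** A face of size d contains i0 or i1, so the remainder in [prod_rank_sum]
vanishes once the rank d is reached. *)
Lemma prod_rank_sum_trace : (0 < d)%N ->
  exists W, piSd (\prod_(j < d) rank_sum j) = piSd (W + actPolySd tau W).
Proof.
move=> d_gt0; have [W ->] := prod_rank_sum d; exists W.
have lt_d : (d.-1 < d)%N by rewrite prednK.
by rewrite (bigD1 (Ordinal lt_d)) //= avoid_sum_max // mul0r rmorph0 add0r.
Qed.

(** * Identifying two variables *)

Definition identify : {mpoly k[d.+1]} -> {mpoly k[d.+1]} :=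
  comp_mpoly [tuple 'X_(if i == i1 then i0 else i) | i < d.+1].

HB.instance Definition _ := GRing.RMorphism.copy identify
  (comp_mpoly [tuple 'X_(if i == i1 then i0 else i) | i < d.+1]).

Lemma identify_msym p : identify (msym tau p) = identify p.
Proof.
rewrite /identify msym_mPo; congr (_ \mPo _); apply: eq_from_tnth => i.
rewrite !tnth_mktuple; congr 'X__.
case: tpermP => [->|->|]; rewrite ?eqxx ?(negPf neq_i) //.
Qed.

(** Among the squarefree monomials of degree #|A|, only the one of A is nonzero
at the indicator of A; and that point lies on the hyperplane x_i0 = x_i1. *)
Lemma identify_mesym (A : {set 'I_d.+1}) :
  (i0 \in A) = (i1 \in A) -> identify (mesym d.+1 k #|A|) != 0.
Proof.
move=> A01; apply/eqP => /(congr1 (meval (fun i => (i \in A)%:R))).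
rewrite rmorph0 /identify comp_mpoly_meval.
under meval_eq => i.
  rewrite tnth_mktuple mevalXU (_ : (_ \in A) = (i \in A)); last first.
    by case: eqP => // ->.
  over.
rewrite /mesym raddf_sum (bigD1 A) //= [X in _ + X]big1 ?addr0; last first.
  move=> B /andP[/eqP cB nBA].
  rewrite rmorph_prod /=.
  have [v vB vA] : exists2 v, v \in B & v \notin A.
    apply/subsetPn; apply: contra nBA => sBA.
    by rewrite eqEcard sBA cB leqnn.
  by rewrite (bigD1 v) //= mevalXU (negPf vA) mul0r.
rewrite rmorph_prod big1 => [/eqP|v vA]; first by rewrite oner_eq0.
by rewrite /= mevalXU vA.
Qed.

End InvariantProduct.

(** * Projection to a complete flag *)

Section FlagProjection.
Variables (d : nat) (k : fieldType).

Definition initial_face (a : face d) : bool :=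
  val a == [set i : 'I_d.+1 | (i < #|val a|)%N].

(** Variables are numbered from 0, whence the predecessor of the size. *)
Definition flag_proj : {mpoly k[#|{: face d}|]} -> {mpoly k[d.+1]} :=
  comp_mpoly [tuple let a := enum_val i : face d in
    if initial_face a then 'X_(inord #|val a|.-1) else 0
   | i < #|{: face d}|].

HB.instance Definition _ := GRing.RMorphism.copy flag_proj
  (comp_mpoly [tuple let a := enum_val i : face d in
    if initial_face a then 'X_(inord #|val a|.-1) else 0
   | i < #|{: face d}|]).

Lemma flag_projY a : flag_proj (Y k a) =
  if initial_face a then 'X_(inord #|val a|.-1) else 0.
Proof. by rewrite /flag_proj /Y comp_mpolyXU -tnth_nth tnth_mktuple enum_rankK. Qed.

(** Two initial faces are always comparable. *)
Lemma flag_proj_ideal p : p \in @in_idealSd d k -> flag_proj p = 0.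
Proof.
move=> /asboolP[c ->]; rewrite rmorph_sum big1 // => a _.
rewrite rmorph_sum big1 // => b; rewrite /incomparable => /andP[ab ba].
rewrite !rmorphM /= !flag_projY.
case: ifPn => [/eqP Ea|]; last by rewrite mul0r mulr0.
case: ifPn => [/eqP Eb|]; last by rewrite !mulr0.
case/orP: (leq_total #|val a| #|val b|) => le.
  case/negP: ab; rewrite Ea Eb; apply/subsetP => i; rewrite !inE => /leq_trans.
  exact.
case/negP: ba; rewrite Ea Eb; apply/subsetP => i; rewrite !inE => /leq_trans.
exact.
Qed.

(** The flag has exactly one face of each size. *)
Lemma flag_proj_gammas q : flag_proj (q \mPo gammas d k) = q.
Proof.
rewrite -[RHS]comp_mpoly_id.
elim/mpolyind: q => [|c m p _ _ IH]; first by rewrite !rmorph0.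
rewrite !rmorphD /= IH; congr (_ + _).
rewrite -mul_mpolyC !rmorphM /= !comp_mpolyC; congr (_ * _).
  exact: comp_mpolyC.
rewrite !comp_mpolyX rmorph_prod; apply: eq_bigr => i _.
rewrite rmorphXn /= !tnth_mktuple; congr (_ ^+ _).
have cI := card_initial (ltn_ord i).
have n0 : [set v : 'I_d.+1 | (v < i.+1)%N] != set0.
  by rewrite -cards_eq0 cI.
pose a : face d :=
  exist (fun A : {set 'I_d.+1} => is_true (A != set0)) _ n0.
rewrite rmorph_sum (bigD1 a) /= ?cI // big1 ?addr0.
  by rewrite flag_projY /initial_face /= cI eqxx inord_val.
move=> b /andP[/eqP cb nb]; rewrite flag_projY /initial_face cb.
case: ifP => // /eqP Eb; case/eqP: nb; exact: val_inj.
Qed.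

End FlagProjection.

(** * Equivariant isomorphisms *)

Lemma actDeltaE d k (s : 'S_d.+1) (p : kDelta d k) : actDelta s p = msym s p.
Proof. by []. Qed.

Lemma actSd1 d k (s : 'S_d.+1) : actSd s (1 : kSd d k) = 1.
Proof. by rewrite -(rmorph1 (@piSd d k)) actSd_pi /= !rmorph1. Qed.

(** 1 is invariant, so its image is a symmetric polynomial. *)
Lemma equivariant_one_theta d k (f : {linear kSd d k -> kDelta d k}) :
  (forall (s : 'S_d.+1) (u : kSd d k), f (actSd s u) = actDelta s (f u)) ->
  exists q : {mpoly k[d.+1]}, f 1 = q \mPo thetas d k.
Proof.
move=> fG; have /sym_fundamental[q [<- _]] : (f 1 : {mpoly k[d.+1]}) \is symmetric.
  by apply/issymP => s; rewrite -[RHS](congr1 f (actSd1 k s)) fG.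
by exists q.
Qed.

(** Linearity gives q(theta) g(1) = g(f 1) = 1 for the inverse g of f: hence
q(gamma) divides 1 in k[Sd Delta_d], and the flag projection returns q. *)
Lemma theta_unit_of_iso d k (f : {linear kSd d k -> kDelta d k}) q :
  bijective f -> f 1 = q \mPo thetas d k -> exists q', q * q' = 1.
Proof.
move=> [g fK gK] f1.
have q_in : q \mPo thetas d k \in @in_kTheta d k by apply/asboolP; exists q.
pose a := KTheta q_in.
have a_g1 : a *: g 1 = 1.
  apply: (can_inj fK); rewrite linearZ gK f1.
  exact: mulr1.
have : piSd ((q \mPo gammas d k) * generic_quotient.repr (g 1)) = piSd 1.
  rewrite rmorphM rmorph1 /= piSd_repr -a_g1.
  by congr (_ * _); rewrite (@thetaToSdE _ _ a q).
move=> /eq_piSd /flag_proj_ideal /eqP.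
rewrite rmorphB rmorphM rmorph1 /= flag_proj_gammas subr_eq0 => /eqP e.
by eexists; exact: e.
Qed.

(* The scalars of [{linear _ -> _}] are k[Theta] ([kTheta d k]), the only ring *)
(* over which [kSd d k] and [kDelta d k] carry a module structure.            *)
Theorem theorem1p2 (d : nat) (k : fieldType) (d_ge2 : (2 <= d)%N)
    (char_k : 2%N \in [pchar k]) :
  ~ exists f : {linear kSd d k -> kDelta d k},
      bijective f /\
      (forall (s : 'S_d.+1) (u : kSd d k), f (actSd s u) = actDelta s (f u)).
Proof.
move=> [f [f_bij fG]].
have [q f1] := equivariant_one_theta fG.
have [q' qq'] := theta_unit_of_iso f_bij f1.
pose i0 : 'I_d.+1 := ord0; pose i1 : 'I_d.+1 := inord 1.
have i01 : i0 != i1 by rewrite -val_eqE /= inordK // ltnW.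
pose h : {rmorphism {mpoly k[d.+1]} -> {mpoly k[d.+1]}} :=
  @identify d k i0 i1.
have theta_neq0 (j : 'I_d) : h (mesym d.+1 k j.+1) != 0.
  (* The vertex 2 alone if the size is 1, an initial segment otherwise. *)
  have [A [cA A01]] : exists A : {set 'I_d.+1},
      #|A| = j.+1 /\ (i0 \in A) = (i1 \in A).
    case: j => [[|j] /= lt_jd].
      exists [set inord 2]; rewrite cards1 !inE; split=> //.
      by rewrite -!val_eqE /= !inordK // ltnW.
    exists [set i : 'I_d.+1 | (i < j.+2)%N]; split; last first.
      by rewrite !inE /= inordK // ltnW.
    exact: card_initial (leqW lt_jd).
  by rewrite -cA; apply: identify_mesym.
have [W prodW] := prod_rank_sum_trace k i01 (ltnW d_ge2).
pose qprod : {mpoly k[d.+1]} := \prod_(j < d) 'X_(inord j).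
have prod_in : qprod \mPo thetas d k \in @in_kTheta d k.
  by apply/asboolP; exists qprod.
pose b := KTheta prod_in.
have b1 : b *: (1 : kSd d k) = piSd (W + actPolySd (tperm i0 i1) W).
  rewrite -prodW; transitivity (thetaToSd b); first exact: mulr1.
  rewrite (@thetaToSdE _ _ b qprod) // rmorph_prod; congr piSd.
  apply: eq_bigr => j _; rewrite /= comp_mpolyXU -tnth_nth tnth_mktuple.
  by rewrite inordK // ltnS ltnW.
have char2 : 2%N \in [pchar {mpoly k[d.+1]}].
  by rewrite (rmorph_pchar (@mpolyC d.+1 k)).
have fb : f (piSd (W + actPolySd (tperm i0 i1) W)) =
          (qprod \mPo thetas d k) * (q \mPo thetas d k).
  by rewrite -b1 linearZ f1.
(* This is where the characteristic is used: h kills p + tau p. *)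
have : h ((qprod \mPo thetas d k) * (q \mPo thetas d k)) = 0.
  rewrite -fb rmorphD /= -actSd_pi linearD fG rmorphD /= actDeltaE.
  by rewrite identify_msym //; exact: addrr_pchar2 char2 _.
rewrite (rmorphM h) => /eqP; rewrite mulf_eq0 => /orP[|].
  rewrite [qprod \mPo _]rmorph_prod rmorph_prod => /prodf_eq0[j _].
  rewrite /= comp_mpolyXU -tnth_nth tnth_mktuple inordK ?ltnS 1?ltnW // => h0.
  by have := theta_neq0 j; rewrite h0.
move=> /eqP hq; have := oner_neq0 {mpoly k[d.+1]}.
by rewrite -(rmorph1 h) -(comp_mpoly1 (thetas d k)) -qq' !rmorphM /= hq mul0r eqxx.
Qed.
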